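(* Let $q_A,q_B,r_A,r_B>0$ and $m_A,m_B\in\mathbb{R}$, and set $c_1=5\,(r_A^{-2}+r_B^{-2})^{1/2}$, $c_2=\sqrt{q_A^2+q_B^2}\,(1+m_A^2+m_B^2)$. Let $T>0$ satisfy $$T\le \mathcal{T}(m_A,m_B):=(c_1c_2)^{-1/2}\arctan\!\big((1+m_A^2+m_B^2)\,(c_2/c_1)^{-1/2}\big).$$ Then any solution $(\theta^A,\theta^B)$ on $[0,T]$, with values in pairs of real symmetric $2\times2$ matrices, of the coupled Riccati system $$\dot\theta^A=\theta^AR_A\theta^A+\theta^AR_B\theta^B+\theta^BR_B\theta^A-Q_A,$$ $$\dot\theta^B=\theta^BR_B\theta^B+\theta^AR_A\theta^B+\theta^BR_A\theta^A-Q_B,$$ with terminal conditions $\theta^A(T)=\theta^B(T)=0$, satisfies, for all $t\in[0,T]$, $$\|\theta(t)\|_F\le 1+m_A^2+m_B^2,\qquad \theta:=\mathrm{diag}\{\theta^A,\theta^B\}.$$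
   Context: The matrices are $$Q_A=\begin{bmatrix} q_A & -m_Aq_A\\ -m_Aq_A & m_A^2q_A\end{bmatrix},\quad R_A=\begin{bmatrix}1/r_A&0\\0&0\end{bmatrix},\quad Q_B=\begin{bmatrix} m_B^2q_B & -m_Bq_B\\ -m_Bq_B & q_B\end{bmatrix},\quad R_B=\begin{bmatrix}0&0\\0&1/r_B\end{bmatrix}.$$ $\|\cdot\|_F$ denotes the Frobenius norm, and $\mathrm{diag}\{\theta^A,\theta^B\}$ is the $4\times4$ block diagonal matrix with blocks $\theta^A,\theta^B$. *)

(* Defs.v *)
From HB Require Import structures.
From mathcomp Require Import all_boot all_order all_algebra.
From mathcomp Require Import all_classical all_reals all_analysis.

Set Implicit Arguments.
Unset Strict Implicit.
Unset Printing Implicit Defensive.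

Import Order.TTheory GRing.Theory Num.Theory.
Import numFieldNormedType.Exports.

Local Open Scope classical_set_scope.
Local Open Scope ring_scope.

Section Defs.
Context {R : realType}.

Definition mx22 (a b c d : R) : 'M[R]_2 :=
  \matrix_(i < 2, j < 2)
    if i == 0 then (if j == 0 then a else b) else (if j == 0 then c else d).

Definition QA (mA qA : R) : 'M[R]_2 :=
  mx22 qA (- mA * qA) (- mA * qA) (mA ^+ 2 * qA).
Definition RA (rA : R) : 'M[R]_2 := mx22 (1 / rA) 0 0 0.
Definition QB (mB qB : R) : 'M[R]_2 :=
  mx22 (mB ^+ 2 * qB) (- mB * qB) (- mB * qB) qB.
Definition RB (rB : R) : 'M[R]_2 := mx22 0 0 0 (1 / rB).

(* The norm `|A| that the library puts on matrices is the maximum norm,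
   hence a separate definition. *)
Definition frobenius_norm m n (A : 'M[R]_(m, n)) : R :=
  Num.sqrt (\sum_(i < m) \sum_(j < n) A i j ^+ 2).

Definition blockdiag (A B : 'M[R]_2) : 'M[R]_(2 + 2) := block_mx A 0 0 B.

(* The difference quotient is taken along s in D only: at an endpoint of an
   interval this is the one-sided derivative, and values of f outside D are
   irrelevant. *)
Definition has_derivative_within (V : normedModType R)
    (D : set R) (f : R -> V) (t : R) (l : V) : Prop :=
  (s - t)^-1 *: (f s - f t) @[s --> within D t^'] --> l.

Definition riccati_solution (qA qB rA rB mA mB T : R)
    (thA thB : R -> 'M[R]_2) : Prop :=
  [/\ forall t : R, t \in `[0, T] -> (thA t)^T = thA t /\ (thB t)^T = thB t,
      forall t : R, t \in `[0, T] ->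
        has_derivative_within [set` `[0, T]] thA t
          (thA t *m RA rA *m thA t + thA t *m RB rB *m thB t
           + thB t *m RB rB *m thA t - QA mA qA),
      forall t : R, t \in `[0, T] ->
        has_derivative_within [set` `[0, T]] thB t
          (thB t *m RB rB *m thB t + thA t *m RA rA *m thB t
           + thB t *m RA rA *m thA t - QB mB qB)
    & thA T = 0 /\ thB T = 0].

Definition c1 (rA rB : R) : R := 5 * Num.sqrt (rA ^- 2 + rB ^- 2).

Definition c2 (qA qB mA mB : R) : R :=
  Num.sqrt (qA ^+ 2 + qB ^+ 2) * (1 + mA ^+ 2 + mB ^+ 2).

Definition horizon_bound (qA qB rA rB mA mB : R) : R :=
  (Num.sqrt (c1 rA rB * c2 qA qB mA mB))^-1 *
  atan ((1 + mA ^+ 2 + mB ^+ 2) * (Num.sqrt (c2 qA qB mA mB / c1 rA rB))^-1).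

End Defs.

(* Main.v *)
(* Put u := ||diag(thA, thB)||_F. Submultiplicativity of the Frobenius norm and
   the Cauchy-Schwarz inequality turn the Riccati system into the scalar
   inequality - u' <= c1 u^2 + c2 with u(T) = 0. Hence atan (sqrt(c1/c2) u(t))
   decreases in t at rate at most sqrt(c1 c2), so that it is bounded by
   sqrt(c1 c2) T, and the condition on T is exactly that this is at most
   atan (sqrt(c1/c2) (1 + mA^2 + mB^2)). *)
Require Import Defs.
From HB Require Import structures.
From mathcomp Require Import all_boot all_order all_algebra.
From mathcomp Require Import all_classical all_reals all_analysis.
From mathcomp Require Import ring lra.

Set Implicit Arguments.
Unset Strict Implicit.
Unset Printing Implicit Defensive.

Import Order.TTheory GRing.Theory Num.Theory.
Import numFieldNormedType.Exports.

Local Open Scope classical_set_scope.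
Local Open Scope ring_scope.

(** * Frobenius norm: Cauchy-Schwarz, submultiplicativity, block diagonal matrices *)

Section FrobeniusNorm.
Context {R : realType}.

(** With [X], [Y] the sums of squares and [P] the dot product, [Y * (X * Y - P ^+ 2)] is itself a
    sum of squares. Cancelling [Y] requires it to be nonzero; if it is zero, every [y i] vanishes
    and both sides are zero. *)
Lemma sum_cauchy_schwarz (I : finType) (x y : I -> R) :
  (\sum_i x i * y i) ^+ 2 <= (\sum_i x i ^+ 2) * (\sum_i y i ^+ 2).
Proof.
set X := \sum_i x i ^+ 2; set Y := \sum_i y i ^+ 2.
set P := \sum_i x i * y i.
have Y0 : 0 <= Y by apply: sumr_ge0 => i _; exact: sqr_ge0.
have [Y_eq0|Yneq0] := eqVneq Y 0.
  have y0 i : y i = 0.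
    apply/eqP; rewrite -sqrf_eq0; apply/eqP.
    by apply: (psumr_eq0P _ Y_eq0) => // j _; exact: sqr_ge0.
  by rewrite /P big1 ?expr0n ?Y_eq0 ?mulr0// => i _; rewrite y0 mulr0.
have Ypos : 0 < Y by rewrite lt_neqAle eq_sym Yneq0.
suff : 0 <= Y * (X * Y - P ^+ 2) by rewrite pmulr_rge0// subr_ge0.
have -> : Y * (X * Y - P ^+ 2) = \sum_i (Y * x i - P * y i) ^+ 2.
  transitivity (\sum_i (Y ^+ 2 * x i ^+ 2
      + (- (2 * Y * P)) * (x i * y i) + P ^+ 2 * y i ^+ 2)).
    by rewrite !big_split/= -!mulr_sumr -/X -/Y -/P; ring.
  by apply: eq_bigr => i _; ring.
by apply: sumr_ge0 => i _; exact: sqr_ge0.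
Qed.

Definition frobenius_dot m n (A B : 'M[R]_(m, n)) : R :=
  \sum_(i < m) \sum_(j < n) A i j * B i j.

Lemma frobenius_norm_ge0 m n (A : 'M[R]_(m, n)) : 0 <= frobenius_norm A.
Proof. exact: sqrtr_ge0. Qed.

Lemma sqr_frobenius_norm m n (A : 'M[R]_(m, n)) :
  frobenius_norm A ^+ 2 = \sum_(i < m) \sum_(j < n) A i j ^+ 2.
Proof.
by rewrite sqr_sqrtr// sumr_ge0// => i _; rewrite sumr_ge0// => j _; exact: sqr_ge0.
Qed.

Lemma frobenius_cauchy_schwarz m n (A B : 'M[R]_(m, n)) :
  `|frobenius_dot A B| <= frobenius_norm A * frobenius_norm B.
Proof.
rewrite -ler_sqr ?nnegrE ?mulr_ge0 ?frobenius_norm_ge0// exprMn.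
rewrite !sqr_frobenius_norm -normrX ger0_norm ?sqr_ge0// /frobenius_dot !pair_bigA/=.
exact: (sum_cauchy_schwarz (fun p : 'I_m * 'I_n => A p.1 p.2)
  (fun p => B p.1 p.2)).
Qed.

Lemma frobenius_normN m n (A : 'M[R]_(m, n)) :
  frobenius_norm (- A) = frobenius_norm A.
Proof.
congr Num.sqrt; apply: eq_bigr => i _; apply: eq_bigr => j _.
by rewrite mxE sqrrN.
Qed.

Lemma ler_frobenius_normD m n (A B : 'M[R]_(m, n)) :
  frobenius_norm (A + B) <= frobenius_norm A + frobenius_norm B.
Proof.
rewrite -ler_sqr ?nnegrE ?addr_ge0 ?frobenius_norm_ge0//.
have -> : frobenius_norm (A + B) ^+ 2 =
    frobenius_norm A ^+ 2 + 2 * frobenius_dot A B + frobenius_norm B ^+ 2.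
  rewrite !sqr_frobenius_norm /frobenius_dot mulr_sumr -!big_split/=.
  apply: eq_bigr => i _; rewrite mulr_sumr -!big_split/=.
  by apply: eq_bigr => j _; rewrite mxE; ring.
rewrite sqrrD lerD2r lerD2l mulr_natl lerMn2r/=.
exact: le_trans (ler_norm _) (frobenius_cauchy_schwarz A B).
Qed.

(** Each entry of the product is a row of [A] dotted with a column of [B]. Cauchy-Schwarz bounds its
    square, and the sum of these bounds over all rows and columns factors. *)
Lemma ler_frobenius_normM m n p (A : 'M[R]_(m, n)) (B : 'M[R]_(n, p)) :
  frobenius_norm (A *m B) <= frobenius_norm A * frobenius_norm B.
Proof.
rewrite -ler_sqr ?nnegrE ?mulr_ge0 ?frobenius_norm_ge0// exprMn.
rewrite !sqr_frobenius_norm [X in _ * X]exchange_big/= mulr_suml.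
apply: ler_sum => i _; rewrite mulr_sumr; apply: ler_sum => j _.
rewrite mxE; exact: sum_cauchy_schwarz.
Qed.

Lemma frobenius_norm_mx22 (a b c d : R) :
  frobenius_norm (mx22 a b c d) =
  Num.sqrt (a ^+ 2 + b ^+ 2 + c ^+ 2 + d ^+ 2).
Proof.
by rewrite /frobenius_norm !big_ord_recl !big_ord0 !mxE/= !addr0 !addrA.
Qed.

Lemma sqr_frobenius_norm_blockdiag (A B : 'M[R]_2) :
  frobenius_norm (blockdiag A B) ^+ 2 =
  frobenius_norm A ^+ 2 + frobenius_norm B ^+ 2.
Proof.
rewrite !sqr_frobenius_norm big_split_ord/=; congr (_ + _).
  apply: eq_bigr => i _; rewrite big_split_ord/= [X in _ + X]big1 ?addr0.
    by apply: eq_bigr => j _; rewrite block_mxEul.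
  by move=> j _; rewrite block_mxEur mxE expr0n.
apply: eq_bigr => i _; rewrite big_split_ord/= big1 ?add0r.
  by apply: eq_bigr => j _; rewrite block_mxEdr.
by move=> j _; rewrite block_mxEdl mxE expr0n.
Qed.

End FrobeniusNorm.

(** * Derivatives relative to a subset, and calculus of the squared Frobenius norm *)

Section Derivatives.
Context {R : realType}.

Lemma has_derivative_within_coord m n (D : set R) (f : R -> 'M[R]_(m, n))
    (t : R) (l : 'M[R]_(m, n)) i j :
  has_derivative_within D f t l ->
  has_derivative_within D (fun s => f s i j) t (l i j).
Proof.
move=> /(cvg_comp _ _) /(_ (@coord_continuous _ _ _ i j l)).
by apply: cvg_trans; apply: near_eq_cvg; near=> s => /=; rewrite !mxE.
Unshelve. all: by end_near. Qed.

(** Away from [t], [f s] is [s - t] times the difference quotient plus [f t], and the product tends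
    to [0 * l]. *)
Lemma has_derivative_within_cvg (D : set R) (f : R -> R) (t l : R) :
  has_derivative_within D f t l -> f s @[s --> within D (nbhs t)] --> f t.
Proof.
move=> dfl.
have dt : (s - t) @[s --> within D t^'] --> (0 : R).
  rewrite -(subrr t); apply: cvgB; last exact: cvg_cst.
  by do 2!apply: cvg_within_filter; exact: cvg_id.
have fcvg : (s - t) * ((s - t)^-1 *: (f s - f t)) + f t
    @[s --> within D t^'] --> f t.
  rewrite -[X in _ --> X]add0r -(mul0r l).
  by apply: cvgD; [exact: cvgM dt dfl|exact: cvg_cst].
have {}fcvg : f s @[s --> within D t^'] --> f t.
  move: fcvg; apply: cvg_trans; apply: near_eq_cvg.
  rewrite near_withinE; near=> s => _ /=.
  have st : s != t by near: s; exact: nbhs_dnbhs_neq.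
  by rewrite /GRing.scale/= mulrA mulfV ?subr_eq0// mul1r subrK.
move=> U Uft.
have UD : \forall s \near t, s != t -> D s -> U (f s) := fcvg U Uft.
(* The punctured filter leaves out [s = t]; there the claim holds because [U] is a neighbourhood of
   [f t]. *)
suff : \forall s \near t, D s -> U (f s) by [].
apply: filterS UD => s UDs Ds.
by have [->|st] := eqVneq s t; [exact: nbhs_singleton|exact: UDs].
Unshelve. all: by end_near. Qed.

(** At an interior point [D] is a neighbourhood of [t], so the restriction to [D] drops out of the
    limit; the rest is the change of variable [s = h + t]. *)
Lemma has_derivative_within_is_derive (D : set R) (f : R -> R) (t l : R) :
  D° t -> has_derivative_within D f t l -> is_derive t 1 f l.
Proof.
move=> Dt dfl.
have h : h^-1 *: ((f \o shift t) (h *: 1) - f t) @[h --> 0^'] --> l.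
  move=> U Ul.
  have UD : \forall s \near t, s != t -> D s ->
    U ((s - t)^-1 *: (f s - f t)) := dfl U Ul.
  have {}UD : \forall s \near t, s != t -> U ((s - t)^-1 *: (f s - f t)).
    by apply: filterS2 UD Dt => s UDs Ds st; exact: UDs.
  move: UD; rewrite (near_shift 0 t) => UD.
  apply: filterS UD => h /=; rewrite subr0 => Uh h0.
  rewrite {2}/GRing.scale/= mulr1; move: Uh; rewrite addrK; apply.
  by rewrite -subr_eq0 addrK.
by apply: DeriveDef; [apply/cvg_ex; exists l|apply/cvg_lim].
Unshelve. all: by end_near. Qed.

(** The square is polynomial in the entries, hence differentiable even where the norm vanishes. *)
Lemma is_derive_sqr_frobenius_norm m n (f : R -> 'M[R]_(m, n))
    (l : 'M[R]_(m, n)) (t : R) :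
  (forall i j, is_derive t 1 (fun s => f s i j) (l i j)) ->
  is_derive t 1 (fun s => frobenius_norm (f s) ^+ 2)
    (2 * frobenius_dot (f t) l).
Proof.
move=> fl.
have -> : (fun s => frobenius_norm (f s) ^+ 2) =
    \sum_(i < m) \sum_(j < n) (fun s => f s i j) ^+ 2.
  apply/funext => s; rewrite sqr_frobenius_norm fct_sumE.
  by apply: eq_bigr => i _; rewrite fct_sumE.
rewrite /frobenius_dot mulr_sumr; apply: is_derive_sum => i.
rewrite mulr_sumr; apply: is_derive_sum => j.
apply: is_derive_eq (is_deriveX 2 (fl i j)) _.
by rewrite /GRing.scale/= expr1 mulrA.
Qed.

(** The general filter covers the one-sided neighbourhoods at the ends of [[0, T]]. *)
Lemma cvg_sqr_frobenius_norm m n (F : set_system R) (FF : Filter F)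
    (f : R -> 'M[R]_(m, n)) (M : 'M[R]_(m, n)) :
  (forall i j, f s i j @[s --> F] --> M i j) ->
  frobenius_norm (f s) ^+ 2 @[s --> F] --> frobenius_norm M ^+ 2.
Proof.
move=> fM.
have -> : (fun s => frobenius_norm (f s) ^+ 2) =
    (fun s => \sum_(i < m) \sum_(j < n) f s i j ^+ 2).
  by apply/funext => s; rewrite sqr_frobenius_norm.
rewrite sqr_frobenius_norm; apply: cvg_big => [|i _]; first exact: add_continuous.
apply: cvg_big => [|j _]; first exact: add_continuous.
exact: cvgM (fM i j) (fM i j).
Qed.

End Derivatives.

(** * Comparison principle for a scalar Riccati inequality *)

Section Comparison.
Context {R : realType}.

(** Mean value theorem: the derivative of [atan] is at most 1. This controls the regularised
    function at the terminal time. *)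
Lemma atan_ge0_le (x : R) : 0 <= x -> atan x <= x.
Proof.
move=> x0.
have [c _] := @MVT_segment R atan (fun y => (1 + y ^+ 2)^-1) 0 x x0
  (fun y _ => is_derive1_atan y)
  (continuous_subspaceT (fun y => @continuous_atan R y)).
rewrite atan0 !subr0 => ->; rewrite ler_piMl// invf_le1 ?lerDl ?sqr_ge0//.
by rewrite ltr_pwDl// sqr_ge0.
Qed.

(* [Num.sqrt v] need not be differentiable where [v] vanishes, so the function
   [atan (k * Num.sqrt (v + e))] is differentiated for [e > 0] instead. *)
Lemma riccati_comparison (T p q : R) (v dv : R -> R) :
  0 < p -> 0 < q -> (forall s, 0 <= v s) -> v T = 0 ->
  (forall s, s \in `]0, T[ -> is_derive s 1 v (dv s)) ->
  {within `[0, T], continuous v} ->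
  (forall s, s \in `]0, T[ ->
    - dv s <= 2 * Num.sqrt (v s) * (p * v s + q)) ->
  forall t, t \in `[0, T] ->
    atan (Num.sqrt (p / q) * Num.sqrt (v t)) <= Num.sqrt (p * q) * (T - t).
Proof.
move=> p0 q0 v0 vT dvP vcont dv_le t; rewrite in_itv/= => /andP[t0 tT].
set k := Num.sqrt (p / q).
have k0 : 0 < k by rewrite sqrtr_gt0 divr_gt0.
have k2 : k ^+ 2 = p / q by rewrite sqr_sqrtr// divr_ge0 ?ltW.
have -> : Num.sqrt (p * q) = k * q.
  rewrite -[in k * q](ger0_norm (ltW q0)) -sqrtr_sqr -sqrtrM ?divr_ge0 ?ltW//.
  by congr Num.sqrt; field; rewrite gt_eqF.
apply/ler_addgt0Pr => e e0.
(* The size of the regularisation is chosen so that [k * w T = k * d = e], whence [g T <= e]. *)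
set d := e / k; have d0 : 0 < d by rewrite divr_gt0.
set w := fun s => Num.sqrt (v s + d ^+ 2).
have w0 s : 0 < w s by rewrite sqrtr_gt0 ltr_wpDl ?exprn_gt0.
have w2 s : w s ^+ 2 = v s + d ^+ 2 by rewrite sqr_sqrtr// addr_ge0 ?sqr_ge0.
have vw s : Num.sqrt (v s) <= w s by rewrite ler_wsqrtr// lerDl sqr_ge0.
set g := fun s => atan (k * w s).
set dg := fun s => (1 + (k * w s) ^+ 2)^-1 * (k * ((2 * w s)^-1 * dv s)).
have sub s : s \in `]t, T[ -> s \in `]0, T[.
  by rewrite !in_itv/= => /andP[ts ->]; rewrite (le_lt_trans t0 ts).
have dgP s : s \in `]t, T[ -> is_derive s 1 g (dg s).
  move=> /sub /dvP dvs.
  have dvd : is_derive s 1 (fun x => v x + d ^+ 2) (dv s).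
    rewrite -[X in is_derive _ _ _ X]addr0.
    exact: (is_deriveD dvs (is_derive_cst (d ^+ 2) s 1)).
  have vd0 : 0 < v s + d ^+ 2 by rewrite ltr_wpDl ?exprn_gt0.
  have dw : is_derive s 1 w ((2 * w s)^-1 * dv s).
    exact: (@is_derive1_comp _ Num.sqrt (fun x => v x + d ^+ 2)
      s _ _ (is_derive1_sqrt vd0) dvd).
  exact: (@is_derive1_comp _ atan (fun x => k * w x) s _ _
      (is_derive1_atan _) (is_deriveZ k dw)).
have gcont : {within `[t, T], continuous g}.
  have sub' : `[t, T] `<=` `[0, T] by apply: subset_itvr; rewrite bnd_simp.
  apply/subspace_continuousP => s ts.
  have vs : v x @[x --> within `[t, T] (nbhs s)] --> v s.
    by move/subspace_continuousP: (continuous_subspaceW sub' vcont); apply.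
  apply: (continuous_cvg _ (f := fun x => k * w x) (h := @atan R)); first exact: continuous_atan.
  apply: cvgMr; apply: (continuous_cvg _ (f := fun x => v x + d ^+ 2)
    (h := @Num.sqrt R)); first exact: sqrt_continuous.
  by apply: cvgD => //; exact: cvg_cst.
have gTe : g T <= e.
  have wT : w T = d by rewrite /w vT add0r sqrtr_sqr gtr0_norm.
  rewrite /g wT mulrC divfK ?gt_eqF//; exact/atan_ge0_le/ltW.
have gvt : atan (k * Num.sqrt (v t)) <= g t.
  by apply: le_atan; rewrite ler_pM2l.
suff : g t - g T <= k * q * (T - t) by lra.
(* The mean value theorem below is applied on a nondegenerate interval, so [t = T] is split off. *)
move: tT; rewrite le_eqVlt => /predU1P[->|tT]; first by rewrite !subrr mulr0.
have [c ctT gE] := MVT tT dgP gcont.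
rewrite -opprB gE -mulNr ler_pM2r ?subr_gt0//.
have kw0 : 0 < 1 + (k * w c) ^+ 2 by rewrite ltr_pwDl// sqr_ge0.
rewrite -mulrN ler_pdivrMl// -mulrN -mulrN.
(* Since [k ^+ 2 = p / q], multiplying [1 + (k * w c) ^+ 2] by [q] gives [p * w c ^+ 2 + q]: the
   derivative of [atan] cancels the Riccati nonlinearity. *)
rewrite [leRHS](_ : _ = k * (p * w c ^+ 2 + q)); last first.
  by rewrite exprMn k2; field; rewrite gt_eqF.
rewrite ler_pM2l// ler_pdivrMl ?mulr_gt0//.
(* The hypothesis speaks of [v c]; both factors of its bound only grow when [v c] is replaced by
   [w c ^+ 2]. *)
apply: le_trans (dv_le _ (sub _ ctT)) _.
have pvq0 : 0 <= p * v c + q by rewrite addr_ge0 ?mulr_ge0 ?v0 ?ltW.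
rewrite ler_pM ?mulr_ge0 ?sqrtr_ge0//.
  by rewrite ler_pM2l.
by rewrite lerD2r ler_pM2l// w2 lerDl sqr_ge0.
Qed.

End Comparison.

(** * Growth estimate for the coupled Riccati vector field *)

Section RiccatiBounds.
Context {R : realType}.

(** [QA] is [qA] times the rank-one matrix built on the vector [(1, - mA)], so its entries have a
    perfect square as sum of squares. The same holds for [QB] with [(- mB, 1)]. *)
Lemma frobenius_norm_QA (mA qA : R) :
  0 < qA -> frobenius_norm (QA mA qA) = qA * (1 + mA ^+ 2).
Proof.
move=> qA0; rewrite frobenius_norm_mx22.
rewrite [X in Num.sqrt X](_ : _ = (qA * (1 + mA ^+ 2)) ^+ 2); last by ring.
by rewrite sqrtr_sqr ger0_norm// mulr_ge0 ?addr_ge0 ?sqr_ge0 ?ltW.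
Qed.

Lemma frobenius_norm_QB (mB qB : R) :
  0 < qB -> frobenius_norm (QB mB qB) = qB * (1 + mB ^+ 2).
Proof.
move=> qB0; rewrite frobenius_norm_mx22.
rewrite [X in Num.sqrt X](_ : _ = (qB * (1 + mB ^+ 2)) ^+ 2); last by ring.
by rewrite sqrtr_sqr ger0_norm// mulr_ge0 ?addr_ge0 ?sqr_ge0 ?ltW.
Qed.

Lemma frobenius_norm_RA (rA : R) :
  0 < rA -> frobenius_norm (RA rA) = rA^-1.
Proof.
move=> rA0; rewrite frobenius_norm_mx22 !expr0n/= !addr0 sqrtr_sqr div1r.
by rewrite ger0_norm// invr_ge0 ltW.
Qed.

Lemma frobenius_norm_RB (rB : R) :
  0 < rB -> frobenius_norm (RB rB) = rB^-1.
Proof.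
move=> rB0; rewrite frobenius_norm_mx22 !expr0n/= !add0r sqrtr_sqr div1r.
by rewrite ger0_norm// invr_ge0 ltW.
Qed.

Lemma frobenius_norm_quad n (X Y P S Q : 'M[R]_n) :
  frobenius_norm (X *m P *m X + X *m S *m Y + Y *m S *m X - Q) <=
  frobenius_norm P * frobenius_norm X ^+ 2 +
  2 * frobenius_norm S * frobenius_norm X * frobenius_norm Y +
  frobenius_norm Q.
Proof.
have M3 (U V W : 'M[R]_n) : frobenius_norm (U *m V *m W) <=
    frobenius_norm U * frobenius_norm V * frobenius_norm W.
  apply: le_trans (ler_frobenius_normM _ _) _.
  by rewrite ler_wpM2r ?frobenius_norm_ge0// ler_frobenius_normM.
have := ler_frobenius_normD (X *m P *m X + X *m S *m Y + Y *m S *m X) (- Q).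
have := ler_frobenius_normD (X *m P *m X + X *m S *m Y) (Y *m S *m X).
have := ler_frobenius_normD (X *m P *m X) (X *m S *m Y).
rewrite frobenius_normN.
have := M3 X P X; have := M3 X S Y; have := M3 Y S X.
lra.
Qed.

(** Here [a], [b], [u] stand for the norms of the two blocks and of the whole, [al], [be] for the
    norms of [RA], [RB], and [pA], [pB] for those of [QA], [QB]. The source terms are bounded by
    Cauchy-Schwarz in the plane, the cubic ones by replacing [al] and [be] with [r]. *)
Lemma coupled_quadratic_bound (a b u al be r pA pB qA qB N : R) :
  0 <= a -> 0 <= b -> 0 <= u -> u ^+ 2 = a ^+ 2 + b ^+ 2 ->
  0 <= al -> 0 <= be -> r ^+ 2 = al ^+ 2 + be ^+ 2 -> 0 <= r ->
  0 <= qA -> 0 <= qB -> pA <= qA * N -> pB <= qB * N -> 0 <= N ->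
  a * (al * a ^+ 2 + 2 * be * a * b + pA) +
  b * (be * b ^+ 2 + 2 * al * b * a + pB) <=
  u * (5 * r * u ^+ 2 + Num.sqrt (qA ^+ 2 + qB ^+ 2) * N).
Proof.
move=> a0 b0 u0 u2 al0 be0 r2 r0 qA0 qB0 pAN pBN N0.
have au : a <= u by rewrite -ler_sqr ?nnegrE// u2 lerDl sqr_ge0.
have bu : b <= u by rewrite -ler_sqr ?nnegrE// u2 lerDr sqr_ge0.
have alr : al <= r by rewrite -ler_sqr ?nnegrE// r2 lerDl sqr_ge0.
have ber : be <= r by rewrite -ler_sqr ?nnegrE// r2 lerDr sqr_ge0.
have lin : a * qA + b * qB <= u * Num.sqrt (qA ^+ 2 + qB ^+ 2).
  rewrite -ler_sqr ?nnegrE ?addr_ge0 ?mulr_ge0 ?sqrtr_ge0//.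
  rewrite exprMn sqr_sqrtr ?addr_ge0 ?sqr_ge0// u2 -subr_ge0.
  rewrite [X in 0 <= X](_ : _ = (a * qB - b * qA) ^+ 2) ?sqr_ge0//; ring.
have cubic : al * (a ^+ 3 + 2 * a * b ^+ 2) + be * (b ^+ 3 + 2 * a ^+ 2 * b)
    <= 5 * r * u ^+ 3.
  have : al * (a ^+ 3 + 2 * a * b ^+ 2) <= r * (a ^+ 3 + 2 * a * b ^+ 2).
    by rewrite ler_wpM2r// addr_ge0 ?mulr_ge0 ?exprn_ge0.
  have : be * (b ^+ 3 + 2 * a ^+ 2 * b) <= r * (b ^+ 3 + 2 * a ^+ 2 * b).
    by rewrite ler_wpM2r// addr_ge0 ?mulr_ge0 ?exprn_ge0.
  (* With [r] in place of [al] and [be], the cubic terms add up to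
     [r * (a + b) * (a ^+ 2 + a * b + b ^+ 2)]. As [a + b <= 2 * u], this is at most
     [3 * r * u ^+ 3], below the constant 5 of [c1]. *)
  have ab : a * b <= u ^+ 2 / 2.
    by have := sqr_ge0 (a - b); rewrite u2; lra.
  have : (a + b) * (a ^+ 2 + a * b + b ^+ 2) <= (2 * u) * (3 / 2 * u ^+ 2).
    by rewrite ler_pM ?addr_ge0 ?mulr_ge0 ?exprn_ge0//; lra.
  move=> /(ler_wpM2l r0); have : 0 <= r * u ^+ 3 by rewrite mulr_ge0 ?exprn_ge0.
  lra.
have := ler_wpM2r N0 lin; have := ler_wpM2l a0 pAN.
have := ler_wpM2l b0 pBN; lra.
Qed.

(** The left side is minus the derivative of the squared norm along the system. Keeping the factor
    [2 * u] on the right avoids dividing by a norm that may vanish. *)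
Lemma coupled_riccati_growth (qA qB rA rB mA mB : R) (A B : 'M[R]_2) :
  0 < qA -> 0 < qB -> 0 < rA -> 0 < rB ->
  - (2 * frobenius_dot A (A *m RA rA *m A + A *m RB rB *m B
       + B *m RB rB *m A - QA mA qA)
   + 2 * frobenius_dot B (B *m RB rB *m B + A *m RA rA *m B
       + B *m RA rA *m A - QB mB qB)) <=
  2 * frobenius_norm (blockdiag A B) *
  (c1 rA rB * frobenius_norm (blockdiag A B) ^+ 2 + c2 qA qB mA mB).
Proof.
move=> qA0 qB0 rA0 rB0; set u := frobenius_norm (blockdiag A B).
(* Swapping the cross terms turns the second equation into the first with the roles of [A] and [B]
   exchanged, so one norm estimate serves both. *)
rewrite [X in frobenius_dot B (X - _)]addrAC.
set FA := _ - QA mA qA; set FB := _ - QB mB qB.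
have := frobenius_norm_quad A B (RA rA) (RB rB) (QA mA qA).
have := frobenius_norm_quad B A (RB rB) (RA rA) (QB mB qB).
rewrite frobenius_norm_RA// frobenius_norm_RB// frobenius_norm_QA//.
rewrite frobenius_norm_QB// -/FA -/FB => FBle FAle.
have := frobenius_cauchy_schwarz A FA.
have := frobenius_cauchy_schwarz B FB.
rewrite !ler_norml => /andP[dotB _] /andP[dotA _].
have := ler_wpM2l (frobenius_norm_ge0 A) FAle; have := ler_wpM2l (frobenius_norm_ge0 B) FBle.
have [mA2 mB2] := (sqr_ge0 mA, sqr_ge0 mB).
(* Both source norms are enlarged to the common factor that occurs in [c2]. *)
have H1 : qA * (1 + mA ^+ 2) <= qA * (1 + mA ^+ 2 + mB ^+ 2).
  by rewrite ler_pM2l//; lra.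
have H2 : qB * (1 + mB ^+ 2) <= qB * (1 + mA ^+ 2 + mB ^+ 2).
  by rewrite ler_pM2l//; lra.
have H3 : 0 <= 1 + mA ^+ 2 + mB ^+ 2 by lra.
have r2 : Num.sqrt (rA ^- 2 + rB ^- 2) ^+ 2 = rA^-1 ^+ 2 + rB^-1 ^+ 2.
  by rewrite sqr_sqrtr ?exprVn// addr_ge0// invr_ge0 exprn_ge0// ltW.
have rA_inv0 : 0 <= rA^-1 by rewrite invr_ge0 ltW.
have rB_inv0 : 0 <= rB^-1 by rewrite invr_ge0 ltW.
have := coupled_quadratic_bound (frobenius_norm_ge0 A) (frobenius_norm_ge0 B)
  (frobenius_norm_ge0 _) (sqr_frobenius_norm_blockdiag A B) rA_inv0 rB_inv0
  r2 (sqrtr_ge0 _) (ltW qA0) (ltW qB0) H1 H2 H3.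
rewrite -/u -/(c1 _ _) -/(c2 _ _ _ _); lra.
Qed.

End RiccatiBounds.

Theorem proposition1 (R : realType) (qA qB rA rB mA mB T : R)
    (thA thB : R -> 'M[R]_2) :
  0 < qA -> 0 < qB -> 0 < rA -> 0 < rB ->
  0 < T -> T <= horizon_bound qA qB rA rB mA mB ->
  riccati_solution qA qB rA rB mA mB T thA thB ->
  forall t : R, t \in `[0, T] ->
    frobenius_norm (blockdiag (thA t) (thB t)) <= 1 + mA ^+ 2 + mB ^+ 2.
Proof.
move=> qA0 qB0 rA0 rB0 T0 Tle [_ dA dB [AT BT]] t tT.
have N0 : 0 < 1 + mA ^+ 2 + mB ^+ 2 by rewrite -addrA ltr_pwDl// addr_ge0 ?sqr_ge0.
have c10 : 0 < c1 rA rB.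
  by rewrite mulr_gt0// sqrtr_gt0 addr_gt0// invr_gt0 exprn_gt0.
have c20 : 0 < c2 qA qB mA mB.
  by rewrite mulr_gt0// sqrtr_gt0 addr_gt0// exprn_gt0.
set p := c1 rA rB in c10 *; set q := c2 qA qB mA mB in c20 *.
set v := fun s => frobenius_norm (blockdiag (thA s) (thB s)) ^+ 2.
have vE : v = (fun s => frobenius_norm (thA s) ^+ 2) +
              (fun s => frobenius_norm (thB s) ^+ 2).
  by apply/funext => s; rewrite /v sqr_frobenius_norm_blockdiag.
have sqrt_v s : Num.sqrt (v s) = frobenius_norm (blockdiag (thA s) (thB s)).
  by rewrite sqrtr_sqr ger0_norm ?frobenius_norm_ge0.
have frob0 : frobenius_norm (0 : 'M[R]_2) = 0.
  by rewrite /frobenius_norm !big1 ?sqrtr0// => i _; rewrite big1// => j _;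
    rewrite mxE expr0n.
have vT : v T = 0 by rewrite /v sqr_frobenius_norm_blockdiag AT BT frob0 expr0n addr0.
have oo_cc s : s \in `]0, T[ -> s \in `[0, T] by exact: subset_itv_oo_cc.
have interior_T s : s \in `]0, T[ -> ([set` `[0, T]] : set R)° s.
  by move=> sT; rewrite interior_itv_bnd.
pose FA s := thA s *m RA rA *m thA s + thA s *m RB rB *m thB s
  + thB s *m RB rB *m thA s - QA mA qA.
pose FB s := thB s *m RB rB *m thB s + thA s *m RA rA *m thB s
  + thB s *m RA rA *m thA s - QB mB qB.
(* Two-sided derivatives are taken in the open interval; at the endpoints the comparison asks only
   for continuity. *)
have vder s : s \in `]0, T[ -> is_derive s 1 v
    (2 * frobenius_dot (thA s) (FA s) + 2 * frobenius_dot (thB s) (FB s)).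
  move=> sT; rewrite vE.
  apply: is_deriveD; apply: is_derive_sqr_frobenius_norm => i j;
    apply: (has_derivative_within_is_derive (interior_T _ sT));
    apply: has_derivative_within_coord.
  - exact: dA (oo_cc _ sT).
  - exact: dB (oo_cc _ sT).
have vcont : {within `[0, T], continuous v}.
  apply/subspace_continuousP => s sT; rewrite vE.
  apply: cvgD; apply: cvg_sqr_frobenius_norm => i j;
    apply: has_derivative_within_cvg; apply: has_derivative_within_coord.
  - exact: dA sT.
  - exact: dB sT.
have := riccati_comparison c10 c20 (fun s => sqr_ge0 _) vT vder vcont.
move=> /(_ _ t tT); rewrite sqrt_v => ut.
have {}ut : atan (Num.sqrt (p / q) * frobenius_norm (blockdiag (thA t) (thB t)))
    <= Num.sqrt (p * q) * (T - t).
  apply: ut => s sT; rewrite sqrt_v.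
  exact: coupled_riccati_growth.
have pq0 : 0 < Num.sqrt (p * q) by rewrite sqrtr_gt0 mulr_gt0.
have k0 : 0 < Num.sqrt (p / q) by rewrite sqrtr_gt0 divr_gt0.
(* The horizon condition is restated using that [Num.sqrt (p / q)] is the inverse of
   [Num.sqrt (q / p)]. *)
have {}Tle : Num.sqrt (p * q) * T
    <= atan (Num.sqrt (p / q) * (1 + mA ^+ 2 + mB ^+ 2)).
  rewrite -ler_pdivlMl// -[p / q]invf_div sqrtrV.
    by rewrite [_ * (1 + _ + _)]mulrC.
  by rewrite divr_ge0 ?ltW.
(* A norm above the bound would, [atan] being strictly increasing, contradict [ut] and [Tle],
   because [T - t <= T]. *)
rewrite leNgt; apply/negP; rewrite -(ltr_pM2l k0) => /lt_atan.
apply/negP; rewrite -leNgt; apply: le_trans ut (le_trans _ Tle).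
by rewrite ler_pM2l// lerBlDr lerDl; move: tT; rewrite in_itv/= => /andP[].
Qed.
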